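(* Let $G_m^n$ be the preferential attachment random multigraph. For any $\varepsilon > 0$, asymptotically almost surely (as $n\to\infty$) $$ q^*(G_2^n) \le \frac{15+\varepsilon}{16}. $$ Moreover, for any fixed integer $m \ge 3$, asymptotically almost surely $$ q^*(G_m^n) \le \frac{15}{16}. $$
   Context: Preferential attachment model. Let $G_1^0$ be the null graph with no vertices. The process $(G_1^t)_{t\ge 0}$ is defined inductively: given $G_1^{t-1}$, form $G_1^t$ by adding a vertex $v_t$ together with a single edge between $v_t$ and $v_i$, where $i$ is chosen randomly with $\mathbb{P}(i=s) = \deg(v_s,t-1)/(2t-1)$ for $1\le s\le t-1$ and $\mathbb{P}(i=t) = 1/(2t-1)$; here $\deg(v_s,t-1)$ is the degree of $v_s$ in $G_1^{t-1}$ (loops counted twice). For $m\ge 2$, $G_m^t$ is obtained from $G_1^{tm}$, on vertices $v'_1,v'_2,\dots,v'_{tm}$, by identifying $v'_{(j-1)m+1},\dots,v'_{jm}$ to form the vertex $v_j$, for each $1\le j\le t$. $G_m^n$ is in general a multigraph with $mn$ edges, possibly with loops and multiple edges. Modularity: for a (multi)graph $G$ with at least one edge and a partition $\mathcal{A}$ of $V(G)$, $$q_{\mathcal{A}}(G) = \sum_{A \in \mathcal{A}} \left( \frac{e(A)}{|E(G)|} - \frac{(\sum_{v\in A}\deg(v))^2}{4|E(G)|^2}\right),$$ where $e(A)$ is the number of edges (counted with multiplicity, loops included) with both endpoints in $A$ and loops contribute $2$ to degrees. The modularity is $q^*(G) = \max_{\mathcal{A}} q_{\mathcal{A}}(G)$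 over all partitions $\mathcal{A}$ of $V(G)$. An event holds asymptotically almost surely if its probability tends to $1$ as $n\to\infty$. *)

(* Defs.v *)
From mathcomp Require Import all_boot all_order all_algebra.
From mathcomp Require Import all_classical all_reals all_analysis.

Set Implicit Arguments.
Unset Strict Implicit.
Unset Printing Implicit Defensive.

Import Order.TTheory GRing.Theory Num.Theory.

Local Open Scope ring_scope.

(* A multigraph with vertex set V and k edges is the list of its edges, each
   given by its two (possibly equal) ends; the orientation (e.1, e.2) of an
   edge carries no meaning. *)
Definition mgraph (V : finType) (k : nat) := k.-tuple (V * V).

Section Modularity.
Variables (V : finType) (k : nat).
Implicit Types (G : mgraph V k) (P : {set {set V}}).

(* A loop at v contributes 2. *)
Definition deg G (v : V) : nat :=
  (\sum_(e <- G) ((e.1 == v) + (e.2 == v)))%N.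

Definition edges_in G (A : {set V}) : nat :=
  count (fun e => (e.1 \in A) && (e.2 \in A)) G.

Definition part_modularity (R : realType) G P : R :=
  \sum_(A in P) ((edges_in G A)%:R / k%:R
                 - (\sum_(v in A) deg G v)%:R ^+ 2 / (4 * k%:R ^+ 2)).

(* The partition into singletons is only there to provide the base value that
   an iterated maximum requires; it is one of the competing partitions, see
   [modularityP]. The unqualified name [partition] is that of
   classical_sets. *)
Definition modularity (R : realType) G : R :=
  \big[Num.max/part_modularity R G (preim_partition id [set: V])]_
    (P | finset.partition P [set: V]) part_modularity R G P.

Lemma modularityP (R : realType) G :
  (forall P, finset.partition P [set: V] -> part_modularity R G P <= modularity R G)
  /\ exists2 P, finset.partition P [set: V] & modularity R G = part_modularity R G P.
Proof.
split=> [P PV|]; first exact: le_bigmax_cond.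
rewrite /modularity; elim/big_ind: _ => [|x y [P PV ->] [Q QV ->]|P PV].
- by exists (preim_partition id [set: V]) => //; exact: preim_partitionP.
- by rewrite /Order.max; case: ifP => _; [exists Q | exists P].
- by exists P.
Qed.

End Modularity.

Section PreferentialAttachment.
Variable R : realType.

(* Vertices are numbered from 0: v_1, ..., v_t are the elements of 'I_t, and
   the vertex v_{t+1} added to a graph on 'I_t is ord_max : 'I_t.+1. *)
Definition attach t (G : mgraph 'I_t t) (i : 'I_t.+1) : mgraph 'I_t.+1 t.+1 :=
  [tuple of rcons [seq (lift ord_max e.1, lift ord_max e.2) | e <- G]
                  (ord_max, i)].

(* Adding the (t+1)-st vertex, the normalisation is 2 (t + 1) - 1 = 2 t + 1;
   [unlift ord_max i] is [Some s] when i is the old vertex s, and [None] when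
   i is the new vertex. *)
Definition attach_prob t (G : mgraph 'I_t t) (i : 'I_t.+1) : R :=
  (if unlift ord_max i is Some s then deg G s else 1%N)%:R / (t.*2.+1)%:R.

(* The probability mass function of G_1^t. The type [mgraph 'I_0 0] has the
   null graph as its only element. *)
Fixpoint pa1_law (t : nat) : mgraph 'I_t t -> R :=
  if t is t'.+1 then
    fun G => \sum_(H : mgraph 'I_t' t')
               \sum_(i < t'.+1 | attach H i == G) pa1_law H * attach_prob H i
  else fun=> 1.

Lemma block_subproof n m (j : 'I_(n * m)) : (j %/ m < n)%N.
Proof.
case: m j => [|m] j; last by rewrite ltn_divLR.
by exfalso; case: j => j; rewrite muln0.
Qed.

Definition block n m (j : 'I_(n * m)) : 'I_n := Ordinal (block_subproof j).

(* Passes from G_1^{nm} to G_m^n. *)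
Definition identify_blocks n m (G : mgraph 'I_(n * m) (n * m)) :
    mgraph 'I_n (n * m) :=
  [tuple of [seq (block e.1, block e.2) | e <- G]].

(* The probability that G_m^n satisfies E. *)
Definition pa_prob m n (E : pred (mgraph 'I_n (n * m))) : R :=
  \sum_(G : mgraph 'I_(n * m) (n * m) | E (identify_blocks G)) pa1_law G.

Lemma sum_deg (V : finType) k (G : mgraph V k) :
  (\sum_v deg G v = k.*2)%N.
Proof.
rewrite exchange_big /= -[RHS]muln2 -{2}(size_tuple G).
elim: (tval G) => [|e s IH]; first by rewrite big_nil.
rewrite big_cons IH big_split /= mulSn; congr addn.
have H (x : V) : (\sum_v (x == v) = 1)%N.
  by rewrite (bigD1 x) //= eqxx big1 // => v /negbTE; rewrite eq_sym => ->.
by rewrite !H.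
Qed.

Lemma sum_attach_prob t (G : mgraph 'I_t t) : \sum_i attach_prob G i = 1.
Proof.
rewrite -mulr_suml -natr_sum (bigD1_ord ord_max) //= unlift_none.
under eq_bigr do rewrite liftK.
by rewrite sum_deg add1n divff // pnatr_eq0.
Qed.

Lemma pa1_law_ge0 t (G : mgraph 'I_t t) : 0 <= pa1_law G.
Proof.
elim: t G => [|t IH] G //=.
apply: sumr_ge0 => H _; apply: sumr_ge0 => i _.
by rewrite mulr_ge0 // divr_ge0.
Qed.

Lemma sum_pa1_law t : \sum_(G : mgraph 'I_t t) pa1_law G = 1.
Proof.
elim: t => [|t IH] /=.
  rewrite (bigD1 [tuple]) //= big1 ?addr0 // => G.
  by case/eqP; exact: tuple0.
rewrite exchange_big /= -[RHS]IH; apply: eq_bigr => H _.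
rewrite (exchange_big_dep predT) //=.
rewrite (eq_bigr (fun i => pa1_law H * attach_prob H i)) => [|i _].
  by rewrite -mulr_sumr sum_attach_prob mulr1.
by rewrite (big_pred1 (attach H i)) // => G; exact: eq_sym.
Qed.

End PreferentialAttachment.

(* Main.v *)
Require Import Defs.
From mathcomp Require Import all_boot all_order all_algebra.
From mathcomp Require Import all_classical all_reals all_analysis.
From mathcomp Require Import zify ring lra.

(** A partition of large modularity yields a sparse balanced bipartition. Colour
    the parts of a partition at random with two colours, and let s(v) = 1 or -1
    be the colour of the part of v. The mean of s(u) s(v) is the indicator that
    u and v lie in the same part, so for a graph with k edges the modularity of
    the partition is the mean of
      (1/k) sum_(edges uv) s(u) s(v) - ((1/2k) sum_v deg(v) s(v))^2.
    Some colouring does at least as well as the mean. When the modularity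
    exceeds 15/16, that colouring has r crossing edges and i, j edges inside the
    two colours with 2r/k + ((i - j)/k)^2 < 1/16, hence r < k/32 and
    |i - j| < k/4 ([sparse_balanced_cut]).

    A fixed colouring of the vertices of G_1^N, with N = nm, is very unlikely to
    be such a cut. If no edge crossed, the attachment probabilities would
    multiply to (2i-1)!! (2j-1)!! / (2N-1)!!, which is 1/C(N,i) up to a
    polynomial factor, that is close to 2^-N for balanced colourings. To allow
    for crossing edges one follows a [potential] depending on (i, j, r): the
    reciprocal of this product, times a price for each crossing edge, chosen so
    that the mean of the potential grows by a factor of at most 1 + mu at each
    step ([mean_potential]). With
    mu = 1/32 the mean of the final potential is at most (33/32)^N, while on a
    sparse balanced cut it is at least (50/33)^N / (4 N^2)
    ([potential_sparse_balanced]). By Markov's inequality, the colouring is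
    such a cut with probability at most 4 N^2 (33/40)^(2N).

    The colourings that matter are constant on blocks of m vertices, so there
    are only 2^n of them, and 2 (33/40)^(2m) < 1 as soon as m >= 2: the union
    bound ([pa_prob_modular_le]) tends to 0. *)

Set Implicit Arguments.
Unset Strict Implicit.
Unset Printing Implicit Defensive.

Import Order.TTheory GRing.Theory Num.Theory.
Import numFieldNormedType.Exports.

Local Open Scope ring_scope.

(** * From modularity to sparse balanced cuts *)

Section EdgeCounts.
Variable T : Type.
Implicit Types (c : pred T) (s : seq (T * T)).

Definition inside c s : nat := count (fun e => c e.1 && c e.2) s.
Definition crossing c s : nat := count (fun e => c e.1 != c e.2) s.

Lemma size_inside_crossing c s :
  (inside c s + inside (predC c) s + crossing c s)%N = size s.
Proof.
elim: s => //= e s <-; rewrite /inside /crossing /=.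
by case: (c e.1); case: (c e.2) => /=; lia.
Qed.

End EdgeCounts.

Section TwoColours.
Variable R : realType.

Definition sign (b : bool) : R := if b then 1 else -1.

(** Flipping the value of [f] at [a] changes the sign of the product when [b]
    differs from [a], so these terms cancel in pairs. *)
Lemma sum_sign_mul (I : finType) (a b : I) :
  \sum_(f : {ffun I -> bool}) sign (f a) * sign (f b)
  = if a == b then #|{ffun I -> bool}|%:R else 0.
Proof.
case: eqVneq => [<-|ab].
  rewrite (eq_bigr (fun=> 1)) ?sumr_const // => f _.
  by rewrite /sign; case: (f a); rewrite ?mulrNN mulr1.
set X := \sum_f _.
pose flip (f : {ffun I -> bool}) := [ffun i => (i == a) (+) f i].
have flipK : involutive flip.
  by move=> f; apply/ffunP => i; rewrite !ffunE addbA addbb.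
suff : X = - X by move/eqP; rewrite eq_sym eqNr => /eqP.
rewrite {1}/X (reindex_inj (inv_inj flipK)) /= -sumrN.
apply: eq_bigr => f _; rewrite !ffunE eqxx eq_sym (negbTE ab) /=.
by rewrite /sign; case: (f a); rewrite /= ?mulNr ?mul1r ?opprK.
Qed.

(** Twice the modularity of the bipartition into the two colour classes. *)
Definition two_colour_modularity (V : finType) k (G : mgraph V k) (c : pred V) : R :=
  (\sum_(e <- G) sign (c e.1) * sign (c e.2)) / k%:R
  - (\sum_v (deg G v)%:R * sign (c v)) ^+ 2 / (4 * k%:R ^+ 2).

Lemma sum_block_indicator (V : finType) (P : {set {set V}}) (u v : V) :
  finset.partition P [set: V] ->
  \sum_(A in P) ((u \in A) && (v \in A))%:R
  = (finset.pblock P u == finset.pblock P v)%:R :> R.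
Proof.
move=> PV; have [/eqP covP tP _] := and3P PV.
have inP w : w \in finset.cover P by rewrite covP inE.
rewrite (bigD1 (finset.pblock P u)) ?pblock_mem //= big1 ?addr0.
  by rewrite mem_pblock inP /= eq_pblock.
move=> A /andP[AP /eqP nA]; case: (boolP (u \in A)) => //= uA.
by case: nA; rewrite (def_pblock tP AP uA).
Qed.

Lemma part_modularityE (V : finType) k (G : mgraph V k) (P : {set {set V}}) :
  finset.partition P [set: V] ->
  let same u v : R := (finset.pblock P u == finset.pblock P v)%:R in
  part_modularity R G P
  = (\sum_(e <- G) same e.1 e.2) / k%:R
    - (\sum_u \sum_v (deg G u)%:R * (deg G v)%:R * same u v) / (4 * k%:R ^+ 2).
Proof.
move=> PV same; rewrite /part_modularity sumrB -!mulr_suml.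
congr (_ / _ - _ / _).
  under [RHS]eq_bigr do rewrite /same -(sum_block_indicator _ _ PV).
  rewrite exchange_big /=; apply: eq_bigr => A _.
  by rewrite /edges_in -sum1_count big_mkcond natr_sum; apply: eq_bigr => e _; case: ifP.
under [RHS]eq_bigr => u _ do under eq_bigr => v _ do
  rewrite /same -(sum_block_indicator _ _ PV) mulr_sumr.
under [RHS]eq_bigr do rewrite exchange_big.
rewrite exchange_big /=; apply: eq_bigr => A _.
rewrite natr_sum big_mkcond expr2 big_distrlr /=.
apply: eq_bigr => u _; apply: eq_bigr => v _.
by case: (u \in A); case: (v \in A); rewrite ?mulr1 ?mulr0 ?mul0r.
Qed.

(** Modularity is a quadratic form in the indicators that two vertices share a
    part, and these are the correlations of independent random signs of the
    parts: it is the mean two-colour modularity. One colour is drawn for every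
    set of vertices, so that the parts need no indexing. *)
Lemma sum_two_colour_modularity (V : finType) k (G : mgraph V k) (P : {set {set V}}) :
  finset.partition P [set: V] ->
  \sum_(f : {ffun {set V} -> bool})
    two_colour_modularity G (fun v => f (finset.pblock P v))
  = part_modularity R G P * #|{ffun {set V} -> bool}|%:R.
Proof.
move=> PV; rewrite part_modularityE // /two_colour_modularity.
set C := #|_|%:R.
rewrite sumrB -!mulr_suml mulrBl mulrAC [in RHS](mulrAC _ _ C).
have sumE u v : \sum_(f : {ffun {set V} -> bool})
      sign (f (finset.pblock P u)) * sign (f (finset.pblock P v))
    = (finset.pblock P u == finset.pblock P v)%:R * C.
  by rewrite sum_sign_mul; case: eqP => _; rewrite ?mul1r ?mul0r.
congr (_ / _ - _ / _).
  by rewrite exchange_big mulr_suml; apply: eq_bigr => e _; rewrite sumE.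
under eq_bigr => f _ do rewrite expr2 big_distrlr.
rewrite exchange_big mulr_suml; apply: eq_bigr => u _ /=.
rewrite exchange_big mulr_suml; apply: eq_bigr => v _ /=.
rewrite -[RHS]mulrA -sumE mulr_sumr; apply: eq_bigr => f _.
by rewrite mulrACA.
Qed.

Lemma modularity_le_two_colour (V : finType) k (G : mgraph V k) :
  exists c : pred V, modularity R G <= two_colour_modularity G c.
Proof.
have [_ [P PV ->]] := modularityP R G.
(* If every colouring did worse than the partition, so would their mean. *)
apply: contrapT => no_c.
have : \sum_(f : {ffun {set V} -> bool})
    two_colour_modularity G (fun v => f (finset.pblock P v))
  < \sum_(f : {ffun {set V} -> bool}) part_modularity R G P.
  apply: ltr_sum => [|f _].
    by apply/hasP; exists [ffun=> true]; rewrite ?mem_index_enum.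
  by rewrite ltNge; apply/negP => le_q; apply: no_c; eexists; exact: le_q.
by rewrite sum_two_colour_modularity // sumr_const mulr_natr ltxx.
Qed.

Lemma sum_deg_colour (V : finType) k (G : mgraph V k) (F : V -> R) :
  \sum_v (deg G v)%:R * F v = \sum_(e <- G) (F e.1 + F e.2).
Proof.
under eq_bigr do rewrite natr_sum mulr_suml.
rewrite exchange_big /=; apply: eq_bigr => e _.
have one (x : V) : \sum_v (x == v)%:R * F v = F x.
  rewrite (bigD1 x) //= eqxx mul1r big1 ?addr0 // => v /negbTE.
  by rewrite eq_sym => ->; rewrite mul0r.
by under eq_bigr do rewrite natrD mulrDl; rewrite big_split /= !one.
Qed.

Lemma two_colour_modularityE (V : finType) k (G : mgraph V k) (c : pred V) :
  (0 < k)%N ->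
  two_colour_modularity G c
  = 1 - 2 * (crossing c G)%:R / k%:R
    - (((inside c G)%:R - (inside (predC c) G)%:R) / k%:R) ^+ 2.
Proof.
move=> k_gt0; have k0 : k%:R != 0 :> R by rewrite pnatr_eq0 -lt0n.
have szG : (inside c G + inside (predC c) G + crossing c G)%N = k.
  by rewrite size_inside_crossing size_tuple.
have sE : \sum_(e <- G) sign (c e.1) * sign (c e.2)
    = (inside c G)%:R + (inside (predC c) G)%:R - (crossing c G)%:R.
  rewrite /inside /crossing; elim: (tval G) => [|e s IH] /=.
    by rewrite big_nil; lra.
  rewrite big_cons IH /sign.
  by case: (c e.1); case: (c e.2); rewrite /= !natrD; lra.
have dE : \sum_v (deg G v)%:R * sign (c v)
    = 2 * ((inside c G)%:R - (inside (predC c) G)%:R).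
  rewrite sum_deg_colour /inside; elim: (tval G) => [|e s IH] /=.
    by rewrite big_nil; lra.
  rewrite big_cons IH /sign.
  by case: (c e.1); case: (c e.2); rewrite /= !natrD; lra.
rewrite /two_colour_modularity sE dE.
have -> : (inside c G)%:R = k%:R - (inside (predC c) G)%:R - (crossing c G)%:R :> R.
  by rewrite -[in RHS](congr1 (fun x => x%:R) szG) !natrD; lra.
by field.
Qed.

(** The constant 15/16 is split between the two defects of the best
    two-colouring: its crossing edges and its imbalance. The two balance
    conditions bound the degree sum [2 * i + r] of a colour by 5/8 of the
    total. *)
Lemma sparse_balanced_cut (V : finType) k (G : mgraph V k) :
  (0 < k)%N -> 15 / 16 < modularity R G ->
  exists c : pred V, let i := inside c G in let j := inside (predC c) G in
    let r := crossing c G in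
    [/\ (32 * r < k)%N, (4 * (2 * i + r) < 5 * k)%N & (4 * (2 * j + r) < 5 * k)%N].
Proof.
move=> k_gt0 big_q; have [c] := modularity_le_two_colour G.
rewrite two_colour_modularityE //= => le_q; exists c.
have szG : (inside c G + inside (predC c) G + crossing c G)%N = k.
  by rewrite size_inside_crossing size_tuple.
move: (inside c G) (inside (predC c) G) (crossing c G) szG le_q => i j r szG le_q.
have kp : 0 < k%:R :> R by rewrite ltr0n.
have r0 : 0 <= r%:R / k%:R :> R by rewrite divr_ge0.
set x := (_ - _) / _ in le_q; set y := r%:R / k%:R in r0.
have {}le_q : 2 * y + x ^+ 2 < 1 / 16 by rewrite -mulrA -/y in le_q; lra.
have x2 : 0 <= x ^+ 2 by exact: sqr_ge0.
have yk : r%:R = y * k%:R by rewrite divfK // gt_eqF.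
have xk : i%:R - j%:R = x * k%:R by rewrite divfK // gt_eqF.
have x_lt : x < 1 / 4 by nra.
have x_gt : - (1 / 4) < x by nra.
have Hr : (32 * r < k)%N.
  by rewrite -(ltr_nat R) natrM yk; nra.
have Hi : (4 * (i - j) < k)%N.
  have [ij|/eqP ->//] := ltnP j i.
  by rewrite -(ltr_nat R) natrM natrB ?(ltnW ij) // xk; nra.
have Hj : (4 * (j - i) < k)%N.
  have [ij|/eqP ->//] := ltnP i j.
  by rewrite -(ltr_nat R) natrM natrB ?(ltnW ij) // -opprB xk; nra.
by split; lia.
Qed.

End TwoColours.

(** * Means over the preferential attachment process *)

Section Mean.
Variable R : realType.

Definition pa1_mean t (F : mgraph 'I_t t -> R) : R :=
  \sum_(G : mgraph 'I_t t) pa1_law R G * F G.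

Lemma pa1_meanS t (F : mgraph 'I_t.+1 t.+1 -> R) :
  pa1_mean F = pa1_mean (fun H => \sum_i attach_prob R H i * F (attach H i)).
Proof.
rewrite /pa1_mean /=; under eq_bigr do rewrite mulr_suml.
rewrite exchange_big /=; apply: eq_bigr => H _.
under eq_bigr do rewrite mulr_suml.
rewrite (exchange_big_dep predT) //= mulr_sumr; apply: eq_bigr => i _.
rewrite (big_pred1 (attach H i)) ?mulrA // => G; exact: eq_sym.
Qed.

Lemma ler_pa1_mean t (F1 F2 : mgraph 'I_t t -> R) :
  (forall G, F1 G <= F2 G) -> pa1_mean F1 <= pa1_mean F2.
Proof. by move=> leF; apply: ler_sum => G _; rewrite ler_wpM2l ?pa1_law_ge0. Qed.

Lemma pa1_meanZ t (F : mgraph 'I_t t -> R) a :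
  pa1_mean (fun G => a * F G) = a * pa1_mean F.
Proof. by rewrite mulr_sumr; apply: eq_bigr => G _; rewrite mulrCA. Qed.

End Mean.

(** One colouring of the natural numbers colours all the graphs of the process,
    and the colour of a vertex does not change when the graph grows. *)
Definition age_colour (c : pred nat) t : pred 'I_t := fun v => c v.
Arguments age_colour : clear implicits.

Section AttachColour.
Variables (c : pred nat) (t : nat) (H : mgraph 'I_t t) (i : 'I_t.+1).

Lemma inside_attach :
  inside (age_colour c t.+1) (attach H i) = (inside (age_colour c t) H + (c t && c i))%N.
Proof.
rewrite /inside /attach /= -cats1 count_cat count_map /= addn0.
by congr (_ + _)%N; apply: eq_count => e /=; rewrite /age_colour !lift_max.
Qed.

Lemma crossing_attach :
  crossing (age_colour c t.+1) (attach H i) = (crossing (age_colour c t) H + (c t != c i))%N.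
Proof.
rewrite /crossing /attach /= -cats1 count_cat count_map /= addn0.
by congr (_ + _)%N; apply: eq_count => e /=; rewrite /age_colour !lift_max.
Qed.

End AttachColour.

(** The new edge picks a colour with probability proportional to the degree sum
    of that colour, where the new vertex already counts for 1. *)
Lemma sum_attach_colour (R : realType) (c : pred nat) t (H : mgraph 'I_t t) (F : bool -> R) :
  let i := inside (age_colour c t) H in
  let j := inside (predC (age_colour c t)) H in
  let r := crossing (age_colour c t) H in
  \sum_x attach_prob R H x * F (c x)
  = ((2 * i + r + c t)%:R * F true + (2 * j + r + ~~ c t)%:R * F false) / (t.*2.+1)%:R.
Proof.
move=> i j r; rewrite (bigD1_ord ord_max) //= /attach_prob unlift_none.
under eq_bigr => s _ do rewrite liftK mulrAC -[bump t s]/(nat_of_ord (lift ord_max s)) lift_max.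
rewrite -mulr_suml mulrAC -mulrDl; congr (_ / _).
rewrite (sum_deg_colour H (fun v => F (c v))) /i /j /r /inside /crossing /age_colour.
have -> : \sum_(e <- H) (F (c e.1) + F (c e.2))
   = (2 * count (fun e : 'I_t * 'I_t => c e.1 && c e.2) H
      + count (fun e : 'I_t * 'I_t => c e.1 != c e.2) H)%:R * F true
     + (2 * count (fun e : 'I_t * 'I_t => ~~ c e.1 && ~~ c e.2) H
      + count (fun e : 'I_t * 'I_t => c e.1 != c e.2) H)%:R * F false.
  elim: (tval H) => [|e s IH] /=; first by rewrite big_nil; lra.
  rewrite big_cons IH.
  by case: (c e.1); case: (c e.2); rewrite /= ?(natrM, natrD); lra.
by case: (c t); rewrite /= ?(natrM, natrD); lra.
Qed.

(** * A potential for two-coloured growth *)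

Section Potential.
Variables (R : realType) (N : nat) (mu : R).
Hypothesis mu_ge0 : 0 <= mu.

Definition odd_fact t : nat := \prod_(u < t) u.*2.+1.

(** Write t = i + j + r and s = r./2. Up to the bounded effect of the parity of
    r, the degree sums of the colours are 2 (i + s) and 2 (j + s), so that
    2^(i+s) (i+s)! and 2^(j+s) (j+s)! play the role of the products of the
    attachment weights inside the colours, and the odd factorial (2t-1)!! is the
    product of the normalisations. The remaining factors price the crossing
    edges: a step from even to odd r costs 1/(2N), since a colour may have a
    degree sum as large as 2N, and the next step gives back 2 (s+1), since
    after 2s + 1 crossings both colours have degree sum at least 2s + 1. Pairing
    the crossings in this way avoids square roots of factorials. The discount mu
    makes the mean contribution of a crossing step small. *)
Definition potential i j r : R :=
  (odd_fact (i + j + r))%:R * mu ^+ r * (r./2)`!%:R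
  / (2 ^+ (i + j + 2 * r./2) * (i + r./2)`!%:R * (j + r./2)`!%:R
     * N%:R ^+ r./2 * (2 * N%:R) ^+ odd r).

Lemma potentialC i j r : potential i j r = potential j i r.
Proof. by rewrite /potential (addnC i j); congr (_ / (_ * _ * _)); rewrite mulrAC. Qed.

Lemma potential_ge0 i j r : 0 <= potential i j r.
Proof. by rewrite /potential divr_ge0 // ?mulr_ge0 ?ler0n ?exprn_ge0. Qed.

(** The new factor 2 (i + s + 1) of the denominator dominates the attachment
    weight 2i + r + 1, because r <= 2s + 1. *)
Lemma potential_inside i j r :
  (2 * i + r).+1%:R * potential i.+1 j r <= (i + j + r).*2.+1%:R * potential i j r.
Proof.
have -> : potential i.+1 j r
    = potential i j r * ((i + j + r).*2.+1%:R / (2 * (i + r./2).+1%:R)).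
  rewrite /potential /odd_fact !addSn big_ord_recr /= factS exprS !natrM !invfM.
  ring.
rewrite mulrCA [leRHS]mulrC; apply: ler_wpM2l; first exact: potential_ge0.
rewrite mulrCA ler_piMr ?ler0n // ler_pdivrMr ?mul1r ?mulr_gt0 ?ltr0n //.
by rewrite -natrM ler_nat; have := odd_double_half r; lia.
Qed.

(** For even r the weight 2j + r is below the price 2N. For odd r the new factor
    2 (j + s + 1) of the denominator dominates it, and the other new factor
    i + s + 1 dominates the s + 1 that is given back. *)
Lemma potential_crossing i j r : (i + j + r < N)%N ->
  (2 * j + r)%:R * potential i j r.+1
  <= (i + j + r).*2.+1%:R * (mu * potential i j r).
Proof.
move=> ltN.
have N_gt0 : (0 < N)%N by lia.
suff [x pE x_le] : exists2 x, potential i j r.+1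
      = potential i j r * (mu * ((i + j + r).*2.+1%:R * x))
    & (2 * j + r)%:R * x <= 1.
  rewrite pE mulrCA [leRHS]mulrA [leRHS]mulrC; apply: ler_wpM2l.
    exact: potential_ge0.
  rewrite mulrCA [leRHS]mulrC ler_wpM2l // mulrCA ler_piMr //.
case: (boolP (odd r)) => odd_r.
  exists ((r./2).+1%:R / (2 * (i + r./2).+1%:R * (j + r./2).+1%:R)).
    rewrite /potential /odd_fact !addnS big_ord_recr /= uphalf_half odd_r /=.
    rewrite !add1n (mulnS 2) add2n !addnS !factS !natrM !exprS expr0 mulr1 !invfM.
    by field; rewrite -!natrD !nat1r !expf_neq0 ?pnatr_eq0 -?lt0n ?fact_gt0 //= N_gt0.
  rewrite mulrA ler_pdivrMr ?mul1r ?mulr_gt0 ?ltr0n //.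
  rewrite -!natrM ler_nat.
  have := odd_double_half r; rewrite odd_r; nia.
exists (2 * N%:R)^-1.
  rewrite /potential /odd_fact !addnS big_ord_recr /= uphalf_half (negbTE odd_r) /=.
  rewrite add0n !natrM !exprS expr0 mulr1 !invfM.
  by field; rewrite !expf_neq0 ?pnatr_eq0 -?lt0n ?fact_gt0 //= N_gt0.
rewrite ler_pdivrMr ?mul1r ?mulr_gt0 ?ltr0n // -natrM ler_nat; lia.
Qed.

(** An edge inside the colour of the new vertex contributes at most the
    potential itself, a crossing edge at most [mu] times it. *)
Lemma mean_potential_attach (c : pred nat) t (H : mgraph 'I_t t) :
  let pot u (G : mgraph 'I_u u) := potential (inside (age_colour c u) G)
    (inside (predC (age_colour c u)) G) (crossing (age_colour c u) G) in
  (t < N)%N ->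
  \sum_x attach_prob R H x * pot _ (attach H x) <= (1 + mu) * pot _ H.
Proof.
move=> pot ltN.
pose F b := potential (inside (age_colour c t) H + (c t && b))
  (inside (predC (age_colour c t)) H + (~~ c t && ~~ b))
  (crossing (age_colour c t) H + (c t != b)).
have potE x : pot _ (attach H x) = F (c x).
  by rewrite /pot (inside_attach c) (inside_attach (predC c)) (crossing_attach c).
under eq_bigr do rewrite potE.
rewrite sum_attach_colour ler_pdivrMr ?ltr0n // /pot /F {F potE pot}.
have := size_inside_crossing (age_colour c t) H; rewrite size_tuple.
move: (inside (age_colour c t) H) (inside (predC _) H) (crossing _ H) => i j r tE.
have ijr : (i + j + r < N)%N by rewrite tE.
have jir : (j + i + r < N)%N by rewrite (addnC j).
have tE' : (j + i + r)%N = t by rewrite (addnC j).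
case: (c t) => /=; rewrite ?(addn0, addn1).
  have := potential_inside i j r; have := potential_crossing ijr.
  by rewrite tE -mulrA; lra.
have := potential_inside j i r; have := potential_crossing jir.
by rewrite tE' (potentialC j.+1) !(potentialC j) -mulrA; lra.
Qed.

Lemma mean_potential (c : pred nat) t : (t <= N)%N ->
  pa1_mean (fun G : mgraph 'I_t t => potential (inside (age_colour c t) G)
    (inside (predC (age_colour c t)) G) (crossing (age_colour c t) G))
  <= (1 + mu) ^+ t.
Proof.
elim: t => [|t IH] ltN.
  rewrite /pa1_mean (bigD1 [tuple]) //= big1 ?addr0 => [|G /eqP[]]; last exact: tuple0.
  by rewrite /potential /odd_fact big_ord0 /= !expr0 !mulr1 invr1.
rewrite pa1_meanS exprS; have {IH} := IH (ltnW ltN).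
have mu1 : 0 < 1 + mu by rewrite ltr_wpDr.
rewrite -(ler_pM2l mu1); apply: le_trans; rewrite -pa1_meanZ; apply: ler_pa1_mean => H.
exact: mean_potential_attach.
Qed.

End Potential.

(** * Binomial and exponential estimates *)

Section Binomials.
Local Open Scope nat_scope.

(** Successive binomial coefficients have the ratio (n - k) / (k + 1), which is
    at most 1 beyond the middle; the other half follows by symmetry. *)
Lemma leq_bin_uphalf n j : 'C(n, j) <= 'C(n, uphalf n).
Proof.
have right d : 'C(n, uphalf n + d) <= 'C(n, uphalf n).
  elim: d => [|d IH]; first by rewrite addn0.
  rewrite addnS; apply: leq_trans IH.
  rewrite -(leq_pmul2l (ltn0Sn (uphalf n + d))) mul_bin_left leq_mul2r.
  by rewrite uphalf_half; have := odd_double_half n; lia.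
have [le_j|lt_j] := leqP (uphalf n) j; first by rewrite -(subnKC le_j).
have half_n : n = odd n + n./2.*2 by rewrite odd_double_half.
have j_half : j <= n./2 by move: lt_j; rewrite uphalf_half; lia.
rewrite -bin_sub; last by lia.
rewrite -(subnKC (_ : uphalf n <= n - j)) //.
by rewrite uphalf_half; lia.
Qed.

Lemma leq_exp2_bin_uphalf n : 2 ^ n <= n.+1 * 'C(n, uphalf n).
Proof.
rewrite -[2]/(1 + 1) expnDn -[n.+1 in leqRHS]card_ord -sum_nat_const.
by apply: leq_sum => j _; rewrite !exp1n !muln1 leq_bin_uphalf.
Qed.

(** As long as k + 1 <= 5n/8, the ratio (n - k) / (k + 1) is at least 3/5. *)
Lemma bin_right_decay n d : 8 * (uphalf n + d) <= 5 * n ->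
  3 ^ d * 'C(n, uphalf n) <= 5 ^ d * 'C(n, uphalf n + d).
Proof.
elim: d => [|d IH] le_n; first by rewrite addn0.
have {}IH : 3 ^ d * 'C(n, uphalf n) <= 5 ^ d * 'C(n, uphalf n + d) by apply: IH; lia.
have step : 3 * 'C(n, uphalf n + d) <= 5 * 'C(n, uphalf n + d.+1).
  rewrite addnS -(leq_pmul2l (ltn0Sn (uphalf n + d))) [leqRHS]mulnCA mul_bin_left.
  by rewrite !mulnA leq_mul2r; lia.
rewrite !expnS -mulnA (leq_trans (leq_mul (leqnn 3) IH)) //.
by rewrite mulnCA -mulnA [leqRHS]mulnCA leq_mul2l step orbT.
Qed.

Lemma odd_fact_ge n : 2 ^ n * n`! <= odd_fact n.+1.
Proof.
rewrite /odd_fact; elim: n => [|n IH]; first by rewrite big_ord_recr big_ord0.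
rewrite big_ord_recr expnS factS mulnACA mulnC leq_mul //.
by rewrite mul2n /=.
Qed.

Lemma exp2_fact_le n : 0 < n -> 2 ^ n * n`! <= 2 * n * odd_fact n.
Proof. by case: n => // n _; rewrite expnS factS mulnACA leq_mul ?odd_fact_ge. Qed.

End Binomials.

Section Estimates.
Variable R : realType.

(** At most n/8 steps lead from the middle to k, each of them loses a factor of
    at most 5/3, and 5/3 <= (16/15)^8; the rate is 15/8 = 2 * 15/16. *)
Lemma balanced_bin_ge k l : (8 * k <= 5 * (k + l))%N -> (8 * l <= 5 * (k + l))%N ->
  (15 / 8) ^+ (k + l) <= (k + l).+1%:R * 'C(k + l, k)%:R :> R.
Proof.
wlog lk : k l / (l <= k)%N => [IH|] le_k le_l.
  have [lk|/ltnW kl] := leqP l k; first exact: IH.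
  rewrite addnC -(bin_sub (leq_addl _ _)) addnK.
  by apply: IH; rewrite // addnC.
set n := (k + l)%N in le_k le_l *.
have le_hk : (uphalf n <= k)%N.
  by have := odd_double_half n; rewrite uphalf_half /n; lia.
have := @bin_right_decay n (k - uphalf n); rewrite subnKC // => /(_ le_k).
set d := (k - _)%N; rewrite -(ler_nat R) !natrM !natrX => decay.
have dn : (8 * d <= n)%N.
  by have := odd_double_half n; rewrite /d uphalf_half; lia.
have := leq_exp2_bin_uphalf n; rewrite -(ler_nat R) natrM natrX => central.
have rate : (5 / 3) ^+ d <= (16 / 15) ^+ n :> R.
  apply: (@le_trans _ _ ((16 / 15) ^+ (8 * d))); last by apply: ler_weXn2l => //; lra.
  by rewrite exprM lerXn2r ?nnegrE ?exprn_ge0 //; lra.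
rewrite (_ : 15 / 8 = 2 * (16 / 15)^-1 :> R); last by lra.
rewrite exprMn exprVn ler_pdivrMr; last by rewrite exprn_gt0 //; lra.
apply: (le_trans central); rewrite -mulrA ler_wpM2l //.
apply: le_trans (_ : (5 / 3) ^+ d * 'C(n, k)%:R <= _); last first.
  by rewrite mulrC ler_wpM2l.
by rewrite expr_div_n mulrAC ler_pdivlMr ?exprn_gt0 // mulrC.
Qed.

(** Because 2 <= (9/8)^6 and 32 = 2^5. *)
Lemma exp32_le r n : (32 * r <= n)%N -> 32 ^+ r <= (9 / 8) ^+ n :> R.
Proof.
move=> le_n; apply: (@le_trans _ _ ((9 / 8) ^+ (30 * r))).
  by rewrite exprM lerXn2r ?nnegrE ?exprn_ge0 //; lra.
by apply: ler_weXn2l; [lra | lia].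
Qed.

(** Each term of the exponential series is at most its sum. *)
Lemma exprn_le_fact_expR (x : R) s : 0 <= x -> x ^+ s <= s`!%:R * expR x.
Proof.
move=> x0; case: s => [|s]; first by rewrite expr0 fact0 mul1r -expR0 ler_expR.
rewrite mulrC -ler_pdivrMr ?ltr0n ?fact_gt0 //.
by apply: le_trans (expR_ge1Dxn s x0); rewrite lerDr.
Qed.

(** Write n = 64 x. Then x^s <= s! e^x with e^(1/64) <= 64/63,
    64^s = 2^(6s) <= (27/25)^(60s) <= (27/25)^n, and (64/63) (27/25) <= 11/10. *)
Lemma exprn_le_fact s n : (64 * s <= n)%N ->
  n%:R ^+ s <= s`!%:R * (11 / 10) ^+ n :> R.
Proof.
move=> le_n; have -> : n%:R = 64 * (n%:R / 64) :> R by field.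
rewrite exprMn.
have e64 : expR (1 / 64) <= 64 / 63 :> R.
  have := expR_ge1Dx (- (1 / 64) : R); rewrite expRN => le_inv.
  rewrite -[leLHS]invrK -[leRHS]invrK lef_pV2 ?posrE ?invr_gt0 ?expR_gt0 //; lra.
have en : expR (n%:R / 64) <= (64 / 63) ^+ n :> R.
  rewrite -[n%:R / 64]mul1r mulrCA expRM_natl lerXn2r ?nnegrE ?expR_ge0 //; lra.
have p64 : 64 ^+ s <= (27 / 25) ^+ n :> R.
  apply: (@le_trans _ _ ((27 / 25) ^+ (60 * s))).
    rewrite exprM lerXn2r ?nnegrE ?exprn_ge0 //; lra.
  by apply: ler_weXn2l; [lra | lia].
have x0 : 0 <= n%:R / 64 :> R by rewrite divr_ge0.
apply: (le_trans (ler_pM _ _ p64 (exprn_le_fact_expR s x0))); rewrite ?exprn_ge0 //.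
rewrite mulrCA ler_wpM2l //.
apply: (le_trans (ler_wpM2l _ en)); first by rewrite exprn_ge0 //; lra.
by rewrite -exprMn lerXn2r ?nnegrE //; lra.
Qed.

End Estimates.

(** * The potential of a sparse balanced cut *)

Section LowerBound.
Variable R : realType.

(** The potential contains (2N-1)!!, which is at least 2^N N! / (2N); this turns
    the factorials into a binomial coefficient, up to the price of the
    crossings. *)
Lemma bin_le_potential N i j r : (i + j + r = N)%N -> (0 < N)%N ->
  'C(i + j + 2 * r./2, i + r./2)%:R
  <= 2 * N%:R * (32 ^+ r * (N%:R ^+ r./2 / (r./2)`!%:R)) * potential N 32^-1 i j r :> R.
Proof.
move=> ijr N_gt0; rewrite /potential ijr.
have rE := odd_double_half r.
set s := r./2 in rE *; set k := (i + s)%N; set l := (j + s)%N.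
have kl : (i + j + 2 * s)%N = (k + l)%N by rewrite /k /l; lia.
rewrite kl.
have NE : N = (k + l + odd r)%N by rewrite /k /l; lia.
have facts : 'C(k + l, k)%:R = (k + l)`!%:R / (k`!%:R * l`!%:R) :> R.
  have := bin_fact (leq_addr l k); rewrite addKn => <-.
  by rewrite !natrM mulfK // mulf_neq0 // pnatr_eq0 -lt0n fact_gt0.
have oddN : 2 ^+ (k + l) * 2 ^+ odd r * ((k + l)`!%:R * N%:R ^+ odd r)
    <= 2 * N%:R * (odd_fact N)%:R :> R.
  have := exp2_fact_le N_gt0; rewrite -(ler_nat R) !natrM natrX => le_odd.
  rewrite -exprD -NE; apply: le_trans le_odd.
  suff -> : (k + l)`!%:R * N%:R ^+ odd r = N`!%:R :> R by [].
  rewrite NE; case: (odd r); last by rewrite addn0 mulr1.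
  by rewrite addn1 expr1 factS natrM mulrC.
rewrite facts; set X := (X in _ <= X).
have -> : X = 2 * N%:R * (odd_fact N)%:R
    / (2 ^+ (k + l) * 2 ^+ odd r * N%:R ^+ odd r * (k`!%:R * l`!%:R)).
  rewrite /X exprVn exprMn; field.
  by rewrite !expf_neq0 ?pnatr_eq0 -?lt0n ?fact_gt0 //= N_gt0.
rewrite ler_pdivlMr; last first.
  by rewrite !mulr_gt0 ?exprn_gt0 ?ltr0n ?fact_gt0.
apply: le_trans oddN; rewrite le_eqVlt; apply/orP; left; apply/eqP.
by field; rewrite !pnatr_eq0 -!lt0n !fact_gt0.
Qed.

(** The binomial coefficient contributes (15/8)^N, the crossings lose at most
    (9/8)^N and (11/10)^N, and 50/33 = (15/8) / (99/80). *)
Lemma potential_sparse_balanced N i j r :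
  (i + j + r = N)%N -> (32 * r < N)%N ->
  (4 * (2 * i + r) < 5 * N)%N -> (4 * (2 * j + r) < 5 * N)%N ->
  (50 / 33) ^+ N <= 4 * N%:R ^+ 2 * potential N 32^-1 i j r :> R.
Proof.
move=> ijr sparse bal_i bal_j.
have N_gt0 : (0 < N)%N by lia.
have := bin_le_potential ijr N_gt0; have rE := odd_double_half r.
have pot_ge0 : 0 <= potential N 32^-1 i j r :> R by apply: potential_ge0; rewrite invr_ge0.
move: (potential _ _ _ _ _) pot_ge0 => w w_ge0.
have e32 := @exp32_le R r N (ltnW sparse).
have efact := @exprn_le_fact R r./2 N.
set s := r./2 in rE efact *.
have -> : (i + j + 2 * s)%N = ((i + s) + (j + s))%N by lia.
set k := (i + s)%N; set l := (j + s)%N.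
move=> bin_le; have {}efact : N%:R ^+ s <= s`!%:R * (11 / 10) ^+ N :> R.
  by apply: efact; lia.
have NE : N = (k + l + odd r)%N by rewrite /k /l; lia.
have le_k : (8 * k <= 5 * (k + l))%N.
  by rewrite /k /l; case: (odd r) rE NE => /=; lia.
have le_l : (8 * l <= 5 * (k + l))%N.
  by rewrite /k /l; case: (odd r) rE NE => /=; lia.
have bin_ge := @balanced_bin_ge R k l le_k le_l.
have binN : (15 / 8) ^+ N <= 2 * N%:R * 'C(k + l, k)%:R :> R.
  (* An odd r loses one factor 15/8, which the factor 2 makes up for. *)
  rewrite NE; case: (odd r); rewrite /= ?addn0 ?addn1.
    rewrite exprS -[leRHS]mulrA ler_pM ?exprn_ge0 //; lra.
  apply: (le_trans bin_ge); rewrite ler_wpM2r // -natrM ler_nat; lia.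
have fs_gt0 : 0 < s`!%:R :> R by rewrite ltr0n fact_gt0.
have errs : 32 ^+ r * (N%:R ^+ s / s`!%:R) <= (99 / 80) ^+ N :> R.
  have -> : 99 / 80 = (9 / 8) * (11 / 10) :> R by lra.
  rewrite exprMn ler_pM ?exprn_ge0 ?divr_ge0 //.
  by rewrite ler_pdivrMr // mulrC.
have -> : 50 / 33 = (15 / 8) / (99 / 80) :> R by lra.
rewrite expr_div_n ler_pdivrMr; last by rewrite exprn_gt0 //; lra.
apply: (le_trans binN).
apply: (le_trans (ler_wpM2l _ bin_le)); first by rewrite mulr_ge0.
rewrite [leLHS](_ : _ = 4 * N%:R ^+ 2 * w * (32 ^+ r * (N%:R ^+ s / s`!%:R))); last by ring.
by rewrite ler_wpM2l // !mulr_ge0 ?exprn_ge0.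
Qed.

End LowerBound.

(** * Union bound over block colourings *)

Section UnionBound.
Variables (R : realType) (n m : nat).
Hypotheses (m_gt0 : (0 < m)%N) (n_gt0 : (0 < n)%N).
Local Notation N := (n * m)%N.

(** A colouring of the n vertices obtained by identification, read on the
    original vertices. *)
Definition block_colour (b : n.-tuple bool) : pred nat := fun x => nth false b (x %/ m).

Lemma identify_block_colour (c : pred 'I_n) (G : mgraph 'I_N N) :
  let b := [tuple c i | i < n] in
  [/\ inside c (identify_blocks G) = inside (age_colour (block_colour b) N) G,
      inside (predC c) (identify_blocks G)
        = inside (predC (age_colour (block_colour b) N)) G
    & crossing c (identify_blocks G) = crossing (age_colour (block_colour b) N) G].
Proof.
move=> b; have cE (x : 'I_N) : age_colour (block_colour b) N x = c (block x).
  by rewrite /age_colour /block_colour -[(x %/ m)%N]/(nat_of_ord (block x)) -tnth_nth tnth_mktuple.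
by split; rewrite /inside /crossing count_map; apply: eq_count => e /=; rewrite !cE.
Qed.

Definition block_potential (b : n.-tuple bool) (G : mgraph 'I_N N) : R :=
  let c := age_colour (block_colour b) N in
  potential N 32^-1 (inside c G) (inside (predC c) G) (crossing c G).

Lemma block_potential_ge0 b G : 0 <= block_potential b G.
Proof. by apply: potential_ge0; rewrite invr_ge0. Qed.

Lemma large_modularity_potential (G : mgraph 'I_N N) :
  15 / 16 < modularity R (identify_blocks G) ->
  exists b, (50 / 33) ^+ N <= 4 * N%:R ^+ 2 * block_potential b G.
Proof.
move=> /sparse_balanced_cut[|c /= [sparse bal_i bal_j]]; first by rewrite muln_gt0 n_gt0.
exists [tuple c i | i < n].
have [iE jE rE] := identify_block_colour c G.
rewrite iE jE rE in sparse bal_i bal_j.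
apply: potential_sparse_balanced => //.
by rewrite size_inside_crossing size_tuple.
Qed.

Lemma pa_prob_compl (E : pred (mgraph 'I_n N)) :
  pa_prob R E = 1 - pa_prob R (predC E).
Proof.
rewrite -(sum_pa1_law R N) (bigID (fun G => E (identify_blocks G))) /=.
by rewrite addrK.
Qed.

Lemma pa_prob_ge0 (E : pred (mgraph 'I_n N)) : 0 <= pa_prob R E.
Proof. by apply: sumr_ge0 => G _; exact: pa1_law_ge0. Qed.

(** Markov's inequality for the sum of the potentials of the 2^n block
    colourings; the rate (33/32) / (50/33) is (33/40)^2. *)
Lemma pa_prob_modular_le :
  pa_prob R (fun G : mgraph 'I_n N => ~~ (modularity R G <= 15 / 16))
  <= 4 * N%:R ^+ 2 * 2 ^+ n * (33 / 40) ^+ (2 * N).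
Proof.
set q := 50 / 33 : R.
have qN : 0 < q ^+ N by rewrite exprn_gt0 // /q; lra.
apply: (@le_trans _ _ (pa1_mean (fun G : mgraph 'I_N N =>
    \sum_b 4 * N%:R ^+ 2 * block_potential b G / q ^+ N))).
  rewrite /pa_prob big_mkcond; apply: ler_sum => G _.
  have term_ge0 b : 0 <= 4 * N%:R ^+ 2 * block_potential b G / q ^+ N.
    by rewrite divr_ge0 ?(ltW qN) // !mulr_ge0 ?block_potential_ge0 ?exprn_ge0.
  case: ifP => [|_]; last by rewrite mulr_ge0 ?pa1_law_ge0 ?sumr_ge0.
  rewrite -ltNge => /large_modularity_potential[b le_b].
  rewrite ler_peMr ?pa1_law_ge0 // (bigD1 b) //=.
  by apply: ler_wpDr; [exact: sumr_ge0 | rewrite ler_pdivlMr // mul1r].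
rewrite /pa1_mean; under eq_bigr do rewrite mulr_sumr.
rewrite exchange_big /=.
have -> : 4 * N%:R ^+ 2 * 2 ^+ n * (33 / 40) ^+ (2 * N)
    = \sum_(b : n.-tuple bool) 4 * N%:R ^+ 2 / q ^+ N * (1 + 32^-1) ^+ N :> R.
  rewrite sumr_const card_tuple card_bool -[RHS]mulr_natr natrX.
  have sq : (33 / 40) ^+ 2 = (1 + 32^-1) / q by rewrite /q; lra.
  rewrite exprM sq expr_div_n; field.
  by rewrite gt_eqF.
apply: ler_sum => b _.
have mu_ge0 : 0 <= 32^-1 :> R by rewrite invr_ge0.
apply: (@le_trans _ _ (4 * N%:R ^+ 2 / q ^+ N * pa1_mean (block_potential b))).
  by rewrite -pa1_meanZ; apply: ler_sum => G _; rewrite [in leRHS]mulrAC.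
rewrite ler_wpM2l ?divr_ge0 ?(ltW qN) ?mulr_ge0 ?exprn_ge0 //.
exact: mean_potential.
Qed.

End UnionBound.

(** * The limit *)

Local Open Scope classical_set_scope.

(** Bernoulli's inequality bounds n y^n; two of the three factors y^n absorb
    n^2. *)
Lemma cvg_sqr_geometric (R : realType) (y : R) : 0 < y -> y < 1 ->
  n%:R ^+ 2 * (y ^+ 3) ^+ n @[n --> \oo] --> (0 : R).
Proof.
move=> y0 y1; set h := y^-1 - 1.
have h0 : 0 < h by rewrite subr_gt0 invf_gt1.
have bernoulli n : n%:R * h <= (1 + h) ^+ n.
  elim: n => [|n IH]; first by rewrite mul0r.
  have one_le : 1 <= (1 + h) ^+ n by rewrite exprn_ege1 // lerDl ltW.
  by rewrite -natr1 exprS; nra.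
have bound n : n%:R * y ^+ n <= h^-1.
  have yE : y = (1 + h)^-1 by rewrite /h addrC subrK invrK.
  rewrite -[leRHS]mul1r ler_pdivlMr // yE exprVn mulrAC ler_pdivrMr ?mul1r //.
  by rewrite exprn_gt0 // addr_gt0.
apply: (@squeeze_cvgr _ _ _ _ (fun=> 0) (fun n => h^-1 ^+ 2 * y ^+ n)).
- near=> n; rewrite mulr_ge0 ?exprn_ge0 ?(ltW y0) //=.
  rewrite exprAC exprS mulrA (_ : _ * _ * _ = (n%:R * y ^+ n) ^+ 2 * y ^+ n); last by ring.
  rewrite ler_wpM2r ?exprn_ge0 ?(ltW y0) // lerXn2r ?nnegrE ?bound //.
    by rewrite mulr_ge0 ?exprn_ge0 ?(ltW y0).
  by rewrite invr_ge0 ltW.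
- exact: cvg_cst.
- by apply: cvg_geometric; rewrite ger0_norm // ltW.
Unshelve. all: by end_near. Qed.

(** The error of the union bound decays geometrically because
    2 (33/40)^4 <= (39/40)^3, up to the factor n^2. *)
Lemma modularity_aas (R : realType) (m : nat) (a : R) : (2 <= m)%N -> 15 / 16 <= a ->
  pa_prob R (fun G : mgraph 'I_n (n * m) => modularity R G <= a)
    @[n --> \oo] --> (1 : R).
Proof.
move=> m2 le_a.
have y_lt1 : 39 / 40 < 1 :> R by lra.
have y_gt0 : 0 < 39 / 40 :> R by lra.
pose err n : R := 4 * m%:R ^+ 2 * (n%:R ^+ 2 * ((39 / 40) ^+ 3) ^+ n).
have x_ge0 : 0 <= 33 / 40 :> R by lra.
have x_le1 : 33 / 40 <= 1 :> R by lra.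
have rate : 2 * (33 / 40) ^+ (2 * m) <= (39 / 40) ^+ 3 :> R.
  apply: (@le_trans _ _ (2 * (33 / 40) ^+ 4)); last by lra.
  by rewrite ler_wpM2l // ler_wiXn2l //; lia.
set x : R := 33 / 40 in x_ge0 x_le1 rate.
apply: (@squeeze_cvgr _ _ _ _ (fun n => 1 - err n) (fun=> 1)).
- near=> n.
  have n_gt0 : (0 < n)%N by near: n; exact: nbhs_infty_gt.
  rewrite pa_prob_compl gerBl pa_prob_ge0 andbT lerB //.
  apply: le_trans (_ : pa_prob R (fun G : mgraph 'I_n (n * m) =>
      ~~ (modularity R G <= 15 / 16)) <= _).
    rewrite /pa_prob [leLHS]big_mkcond [leRHS]big_mkcond; apply: ler_sum => G _ /=.
    have := pa1_law_ge0 R G; case: (leP _ a) => //= gt_a law_ge0; first by case: ifP.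
    by rewrite -ltNge (le_lt_trans le_a gt_a).
  apply: le_trans (pa_prob_modular_le _ _ _) _ => //; first exact: ltnW.
  rewrite -/x [leLHS](_ : _ = 4 * m%:R ^+ 2 * (n%:R ^+ 2 * (2 * x ^+ (2 * m)) ^+ n)).
    rewrite /err !ler_wpM2l ?mulr_ge0 ?exprn_ge0 //.
    by rewrite lerXn2r ?nnegrE ?mulr_ge0 ?exprn_ge0 ?(ltW y_gt0).
  by rewrite natrM mulnA mulnAC exprM !exprMn; ring.
- rewrite -[X in _ --> X](subr0 1); apply: cvgB; first exact: cvg_cst.
  rewrite -(mulr0 (4 * m%:R ^+ 2)); apply: cvgM; first exact: cvg_cst.
  exact: cvg_sqr_geometric.
- exact: cvg_cst.
Unshelve. all: by end_near. Qed.

Theorem theorem13 (R : realType) :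
  (forall eps : R, 0 < eps ->
     pa_prob R (fun G : mgraph 'I_n (n * 2) => modularity R G <= (15 + eps) / 16)
       @[n --> \oo] --> (1 : R)) /\
  (forall m : nat, (3 <= m)%N ->
     pa_prob R (fun G : mgraph 'I_n (n * m) => modularity R G <= 15 / 16)
       @[n --> \oo] --> (1 : R)).
Proof.
split=> [eps eps_gt0 | m m3]; apply: modularity_aas => //; last exact: ltnW.
by rewrite ler_pM2r ?invr_gt0 // lerDl ltW.
Qed.
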